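(* Let $\mathcal{Q}=(Q,\&)$ be a quantale. If for every $\mathcal{Q}$-ordered set $A$ all forward Cauchy ideals of $A$ are flat ideals of $A$, then $\mathcal{Q}$ is meet continuous.
   Context: A quantale $\mathcal{Q}=(Q,\&)$ is always assumed integral and commutative: $Q$ is a complete lattice (bottom $0$, top $1$) and $\&$ is a commutative associative operation on $Q$ with unit $1$ that distributes over arbitrary joins. $\mathcal{Q}$ is meet continuous if $a\wedge\bigvee D=\bigvee_{d\in D}(a\wedge d)$ for all $a\in Q$ and all directed $D\subseteq Q$. A $\mathcal{Q}$-ordered set is a set $A$ with a map $A(-,-):A\times A\to Q$ such that $A(x,x)=1$ and $A(y,z)\&A(x,y)\le A(x,z)$ for all $x,y,z\in A$. A fuzzy lower set of $A$ is a map $\phi:A\to Q$ with $\phi(y)\&A(x,y)\le\phi(x)$ for all $x,y$; a fuzzy upper set is a map $\psi:A\to Q$ with $A(x,y)\&\psi(x)\le\psi(y)$ for all $x,y$. Meets of maps $A\to Q$ are pointwise. For a fuzzy lower set $\phi$ and a fuzzy upper set $\psi$, $\phi\otimes\psi=\bigvee_{x\in A}\phi(x)\&\psi(x)\in Q$. A map $\lambda:A\to Q$ is inhabited if $\bigvee_{a\in A}\lambda(a)=1$. A net $\{x_i\}$ in $A$ is forward Cauchy if $\bigvee_i\bigwedge_{i\le j\le k}A(x_j,x_k)=1$. A fuzzy lower set $\phi$ of $A$ is a forward Cauchy ideal if $\phi=\bigvee_i\bigwedge_{j\ge i}A(-,x_j)$ for some forward Cauchy net $\{x_i\}$ in $A$.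 A fuzzy lower set $\phi$ is a flat ideal if it is inhabited and $\phi\otimes(\psi_1\wedge\psi_2)=(\phi\otimes\psi_1)\wedge(\phi\otimes\psi_2)$ for all fuzzy upper sets $\psi_1,\psi_2$ of $A$. *)

(* Defs.v *)
From HB Require Import structures.
From mathcomp Require Import all_boot all_order.
From mathcomp Require Import boolp classical_sets.
Set Implicit Arguments.
Unset Strict Implicit.
Unset Printing Implicit Defensive.
Import Order.TTheory.
Local Open Scope order_scope.
Local Open Scope classical_set_scope.

(* Directed subsets and index sets of nets are nonempty, as usual. *)

HB.mixin Record hasBigJoin (d : Order.disp_t) T of Order.TBLattice d T := {
  bigjoin : set T -> T;
  bigjoin_lub : forall X : set T, isLub X (bigjoin X)
}.

#[short(type="completeLatticeType")]
HB.structure Definition CompleteLattice (d : Order.disp_t) :=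
  { T of hasBigJoin d T & Order.TBLattice d T }.

HB.mixin Record hasTensor (d : Order.disp_t) T of CompleteLattice d T := {
  tensor : T -> T -> T;
  tensorA : associative tensor;
  tensorC : commutative tensor;
  tensor1q : left_id (\top : T) tensor;
  tensor_bigjoin : forall (a : T) (X : set T),
    tensor a (bigjoin X) = bigjoin [set tensor a x | x in X]
}.

#[short(type="quantaleType")]
HB.structure Definition Quantale (d : Order.disp_t) :=
  { T of hasTensor d T & CompleteLattice d T }.

Notation "a &* b" := (tensor a b) (at level 40, left associativity).

Definition bigmeet (d : Order.disp_t) (T : completeLatticeType d)
  (X : set T) : T := bigjoin (lbound X).

Lemma bigmeet_glb (d : Order.disp_t) (T : completeLatticeType d)
  (X : set T) : infimums X (bigmeet X).
Proof.
have [ub_lb least] := bigjoin_lub (lbound X); split => [x Xx|m lb_m].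
  by apply: least => m; apply.
exact: ub_lb.
Qed.

Definition directed_set (d : Order.disp_t) (T : porderType d) (D : set T) :=
  D !=set0 /\
  forall x y, D x -> D y -> exists z, [/\ D z, x <= z & y <= z].

Definition meet_continuous (d : Order.disp_t) (Q : completeLatticeType d) :=
  forall (a : Q) (D : set Q), directed_set D ->
    Order.meet a (bigjoin D) = bigjoin [set Order.meet a x | x in D].

Record qordered (d : Order.disp_t) (Q : quantaleType d) := QOrdered {
  qcarrier :> Type;
  qhom : qcarrier -> qcarrier -> Q;
  qhom_refl : forall x, qhom x x = \top;
  qhom_trans : forall x y z, qhom y z &* qhom x y <= qhom x z
}.

Record directed_index := DirectedIndex {
  index :> Type;
  index_le : index -> index -> Prop;
  index_refl : forall i, index_le i i;
  index_trans : forall i j k, index_le i j -> index_le j k -> index_le i k;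
  index_inhabited : inhabited index;
  index_directed : forall i j, exists k, index_le i k /\ index_le j k
}.

Section FuzzySets.
Context (d : Order.disp_t) (Q : quantaleType d) (A : qordered Q).

Definition fuzzy_lower (phi : A -> Q) :=
  forall x y, phi y &* qhom x y <= phi x.

Definition fuzzy_upper (psi : A -> Q) :=
  forall x y, qhom x y &* psi x <= psi y.

Definition fuzzy_meet (f g : A -> Q) : A -> Q :=
  fun x => Order.meet (f x) (g x).

Definition fuzzy_tensor (phi psi : A -> Q) : Q :=
  bigjoin [set phi x &* psi x | x in [set: A]].

Definition fuzzy_inhabited (f : A -> Q) :=
  bigjoin [set f x | x in [set: A]] = \top.

Definition forward_cauchy (I : directed_index) (x : I -> A) :=
  bigjoin [set bigmeet [set qhom (x jk.1) (x jk.2) |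
                         jk in [set jk : I * I | index_le i jk.1 /\
                                                 index_le jk.1 jk.2]]
          | i in [set: I]] = \top.

Definition forward_cauchy_ideal (phi : A -> Q) :=
  fuzzy_lower phi /\
  exists (I : directed_index) (x : I -> A), forward_cauchy x /\
    forall a, phi a =
      bigjoin [set bigmeet [set qhom a (x j) | j in [set j | index_le i j]]
              | i in [set: I]].

Definition flat_ideal (phi : A -> Q) :=
  [/\ fuzzy_lower phi, fuzzy_inhabited phi &
      forall psi1 psi2, fuzzy_upper psi1 -> fuzzy_upper psi2 ->
        fuzzy_tensor phi (fuzzy_meet psi1 psi2) =
        Order.meet (fuzzy_tensor phi psi1) (fuzzy_tensor phi psi2)].

End FuzzySets.

(* Main.v *)
Require Import Defs.
From mathcomp Require Import all_boot all_order.
From mathcomp Require Import boolp classical_sets.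

(** A directed set [D] is itself a monotone net, and a monotone net is forward
Cauchy for the crisp order, the one that takes only the values [\top] and
[\bot].  Regard [D] as a crisp Q-ordered set.  The identity net is
eventually above every element of [D], so the forward Cauchy ideal of this net is
the constant map [\top] ([crisp_top_ideal]).  Tensoring with it takes the
plain join of an upper set ([top_tensor]), and every monotone Q-valued map is
a fuzzy upper set of a crisp order ([crisp_upper]).  Flatness of the
constant [\top] therefore says that directed joins of pointwise meets of
monotone maps are meets of directed joins.  For the constant map at [a] and
the inclusion of [D] in Q, this is meet continuity at [a] and [D]. *)

Set Implicit Arguments.
Unset Strict Implicit.
Unset Printing Implicit Defensive.
Import Order.TTheory.
Local Open Scope order_scope.
Local Open Scope classical_set_scope.

Section CompleteLatticeFacts.
Context (d : Order.disp_t) (L : completeLatticeType d).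
Implicit Types (X : set L) (a : L).

Lemma bigjoin_ub X a : X a -> a <= bigjoin X.
Proof. by have [ub _] := bigjoin_lub X; exact: ub. Qed.

Lemma bigjoin_le X a : ubound X a -> bigjoin X <= a.
Proof. by have [_ least] := bigjoin_lub X; exact: least. Qed.

Lemma bigjoin_max X a : X a -> ubound X a -> bigjoin X = a.
Proof. by move=> Xa ubXa; apply/le_anti; rewrite bigjoin_le ?bigjoin_ub. Qed.

Lemma bigmeet_top X : (forall x, X x -> x = \top) -> bigmeet X = \top.
Proof.
move=> Xtop; apply/eqP; rewrite -le1x.
by have [_] := bigmeet_glb X; apply=> x /Xtop ->.
Qed.

End CompleteLatticeFacts.

Section TensorFacts.
Context (d : Order.disp_t) (Q : quantaleType d).
Implicit Types a b c : Q.

(** Distributivity over joins yields monotonicity because [b <= c] makes [c]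
the join of [b] and [c]. *)
Lemma tensor_monor a b c : b <= c -> a &* b <= a &* c.
Proof.
move=> le_bc.
have joinE : bigjoin [set b; c] = c by apply: bigjoin_max => [|x [] ->//]; right.
rewrite -[in leRHS]joinE tensor_bigjoin.
by apply: bigjoin_ub; exists b => //; left.
Qed.

Lemma tensorq1 a : a &* \top = a.
Proof. by rewrite tensorC tensor1q. Qed.

Lemma tensor0q a : \bot &* a = \bot.
Proof.
by apply/eqP; rewrite -lex0 -[leRHS]tensorq1 tensor_monor ?lex1.
Qed.

Lemma tensorq0 a : a &* \bot = \bot.
Proof. by rewrite tensorC tensor0q. Qed.

Lemma top_tensor (A : qordered Q) (psi : A -> Q) :
  fuzzy_tensor (fun=> \top) psi = bigjoin (range psi).
Proof.
rewrite /fuzzy_tensor; congr bigjoin.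
by apply: eq_imagel => x _; rewrite tensor1q.
Qed.

End TensorFacts.

Section CrispOrder.
Context (d : Order.disp_t) (Q : quantaleType d) (I : directed_index).

Definition crisp_hom (i j : I) : Q :=
  if `[< index_le i j >] then \top else \bot.

Lemma crisp_homT i j : index_le i j -> crisp_hom i j = \top.
Proof. by move=> le_ij; rewrite /crisp_hom asboolT. Qed.

Lemma crisp_hom_refl i : crisp_hom i i = \top.
Proof. exact/crisp_homT/index_refl. Qed.

Lemma crisp_hom_trans i j k : crisp_hom j k &* crisp_hom i j <= crisp_hom i k.
Proof.
rewrite {1 2}/crisp_hom.
case: asboolP => [le_jk|_]; last by rewrite tensor0q le0x.
case: asboolP => [le_ij|_]; last by rewrite tensorq0 le0x.
by rewrite (crisp_homT (index_trans le_ij le_jk)) lex1.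
Qed.

Definition crisp_order : qordered Q := QOrdered crisp_hom_refl crisp_hom_trans.

Lemma crisp_upper (psi : crisp_order -> Q) :
  (forall i j : I, index_le i j -> psi i <= psi j) -> fuzzy_upper psi.
Proof.
move=> mono i j /=; rewrite /crisp_hom.
by case: asboolP => [/mono|_]; rewrite ?tensor1q ?tensor0q ?le0x.
Qed.

(** The witness is the identity net.  All its transition values above any
index are [\top], so it is forward Cauchy; and at [a], starting the net at
[a] itself already makes the meet [\top]. *)
Lemma crisp_top_ideal : forward_cauchy_ideal (fun _ : crisp_order => \top : Q).
Proof.
split; first by move=> i j; exact: lex1.
have top_join (X : set Q) : X \top -> bigjoin X = \top.
  by move=> Xtop; apply: bigjoin_max => // x _; exact: lex1.
exists I, id; split=> [|a].
- have [i0] := index_inhabited I.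
  apply: top_join; exists i0 => //.
  by apply: bigmeet_top => _ [[j k] /= [_ le_jk] <-]; exact: crisp_homT.
- apply/esym/top_join; exists a => //.
  by apply: bigmeet_top => _ [j le_aj <-]; exact: crisp_homT.
Qed.

End CrispOrder.

Lemma directed_set_index (d : Order.disp_t) (T : porderType d) (D : set T) :
  directed_set D ->
  exists (I : directed_index) (f : I -> T),
    (forall i j, index_le i j -> f i <= f j) /\ range f = D.
Proof.
move=> [[x0 Dx0] dirD].
pose le (x y : {x | D x}) : Prop := sval x <= sval y.
have le_refl x : le x x by exact: lexx.
have le_tr x y z : le x y -> le y z -> le x z by exact: le_trans.
have le_dir x y : exists z, le x z /\ le y z.
  have [z [Dz le_xz le_yz]] := dirD _ _ (svalP x) (svalP y).
  by exists (exist _ z Dz).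
exists (DirectedIndex le_refl le_tr (inhabits (exist _ x0 Dx0)) le_dir).
exists sval; split=> //.
apply/seteqP; split=> [_ [x _ <-]|x Dx]; first exact: svalP.
by exists (exist _ x Dx).
Qed.

Theorem proposition3p16 (d : Order.disp_t) (Q : quantaleType d)
  (cauchy_flat : forall (A : qordered Q) (phi : A -> Q),
    forward_cauchy_ideal phi -> flat_ideal phi) :
  meet_continuous Q.
Proof.
move=> a D /directed_set_index [I [f [f_mono <-]]].
have [_ _ flat] := cauchy_flat _ _ (crisp_top_ideal Q I).
have up_a : @fuzzy_upper _ _ (crisp_order Q I) (fun=> a) by exact: crisp_upper.
have up_f : @fuzzy_upper _ _ (crisp_order Q I) f by exact: crisp_upper.
have := flat _ _ up_a up_f; rewrite !top_tensor.
have [i0] := index_inhabited I.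
have -> : bigjoin (range (fun _ : crisp_order Q I => a)) = a.
  by apply: bigjoin_max => [|_ [_ _ <-] //]; exists i0.
by move=> <-; rewrite image_comp.
Qed.
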